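(* Suppose $f(x)$ is a real-valued function that is $N$ times continuously differentiable, $N\ge 1$, in a neighborhood of $x=0$ in $\mathbb{R}$, with $f(0)=0$ and $|f'(0)|<1$. If $y=y(x)$ satisfies $$y = x + f(y)$$ in a neighborhood of $0$, then $$ y - \left[\, x + f(x) + \sum_{(k_0,\dots,k_m)\in \Xi_N} C_{k_0,\dots,k_m}\cdot [f(x)]^{k_0}\cdot \prod_{i=1}^m \left[f^{(i)}(x)\right]^{k_i}\right] = o(x^N) $$ as $x\to 0$. Here $$ \Xi_N = \bigcup_{n=1}^\infty\ \bigcup_{m=1}^{\min\{n,N\}} \Big\{(k_0,k_1,\dots,k_m) : 0\le k_i \text{ for } i=1,\dots,m-1,\ 1\le k_m,\ k_0=(n+1)-(k_1+k_2+\cdots+k_m),\ k_1+2k_2+\cdots+mk_m=n\Big\}, $$ and $$ C_{k_0,\dots,k_m} = \frac{(k_1+2k_2+\cdots+mk_m)!}{k_0!}\left(\prod_{i=1}^m k_i!\,(i!)^{k_i}\right)^{-1}. $$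
   Context: Here $N$ is an integer, the $k_i$ are integers, and $f^{(i)}$ denotes the $i$-th derivative of $f$. The length $m+1$ of the tuple $(k_0,\dots,k_m)$ varies over the index set $\Xi_N$. The notation $o(x^N)$ as $x\to 0$ denotes a quantity whose quotient by $x^N$ tends to $0$ as $x\to 0$.
   Formalization: The formal theorem also assumes y(x) → 0 as x → 0; without this the claim fails for other branches, e.g. f(t) = t/2 + 10t³ with y(0) = 1/√20, and the conclusion itself forces it. *)

(* Defs.v *)
From mathcomp Require Import all_boot all_order all_algebra.
From mathcomp Require Import all_classical all_reals all_analysis.

Set Implicit Arguments.
Unset Strict Implicit.
Unset Printing Implicit Defensive.

Import Order.TTheory GRing.Theory Num.Theory.
Import numFieldNormedType.Exports.

Local Open Scope classical_set_scope.
Local Open Scope ring_scope.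

(* A tuple (k_0, ..., k_m) is a [seq nat] of size m + 1. *)
Definition kth (k : seq nat) (i : nat) : nat := nth 0%N k i.

Definition weight (k : seq nat) : nat :=
  (\sum_(1 <= i < size k) i * kth k i)%N.

(* The equation k_0 = (n + 1) - (k_1 + ... + k_m) is written additively because
   subtraction on [nat] is truncated. No tuple with k_0 < 0 is lost:
   k_1 + ... + k_m <= k_1 + 2 k_2 + ... + m k_m = n, so k_0 >= 1. *)
Definition Xi (N : nat) : set (seq nat) :=
  \bigcup_(n in [set n | (1 <= n)%N])
    \bigcup_(m in [set m | (1 <= m <= minn n N)%N])
      [set k | [/\ size k = m.+1,
                   (1 <= kth k m)%N,
                   (kth k 0 + \sum_(1 <= i < m.+1) kth k i = n.+1)%N
                 & (\sum_(1 <= i < m.+1) i * kth k i = n)%N]].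

Definition Ccoef (R : realType) (k : seq nat) : R :=
  (weight k)`!%:R / (kth k 0)`!%:R *
  (\prod_(1 <= i < size k) ((kth k i)`!%:R * i`!%:R ^+ kth k i))^-1.

Definition term (R : realType) (f : R -> R) (x : R) (k : seq nat) : R :=
  Ccoef R k * f x ^+ kth k 0 *
  \prod_(1 <= i < size k) (derive1n i f x) ^+ kth k i.

(* Unordered sum of a real family over a possibly infinite set: the sum of the
   positive parts minus that of the negative parts. It is meaningful only when
   the family is [summable], i.e. absolutely summable. *)
Definition set_sum (R : realType) (T : choiceType) (D : set T) (a : T -> R) : R :=
  fine (\esum_(i in D) (a^\+ i)%:E) - fine (\esum_(i in D) (a^\- i)%:E).

Definition Cn_near (R : realType) (N : nat) (f : R -> R) (a : R) : Prop :=
  \forall x \near a,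
    (forall i, (i < N)%N -> derivable (derive1n i f) x 1) /\ {for x, continuous (derive1n N f)}.

(* Main.v *)
Require Import Defs.
From mathcomp Require Import all_boot all_order all_algebra.
From mathcomp Require Import all_classical all_reals all_analysis.
From mathcomp Require Import ring lra.

Import Order.TTheory GRing.Theory Num.Theory.
Import numFieldNormedType.Exports.

(* Put [w = y - x], [b_i = f^(i)(x) / i!] and [P = \sum_(i <= N) b_i X^i]. As
   [w = f (x + w)], Taylor's formula at [x] gives [w = P(w) + o(w^N)], and
   [w = O(x)]. The bracket minus [x] is the Lagrange series of the exact solution
   of [w = P(w)]. Let [V_n(j)] be the part of degree at most [n] in the [b_i] of
   the formal power [w^j]; then [V_(n+1)(j+1) = \sum_i b_i V_n(j+i)]. In the norm
   [sup_j |.| / r^j] this linear recursion contracts as soon as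
   [\sum_i |b_i| r^i <= t r] with [t < 1], a condition which holds for [x] near 0
   and some fixed [r > 0] because [|f'(0)| < 1]. With [|b_i|] in place of [b_i]
   it yields absolute convergence, and comparing [V_n(j)] with the powers [w^j]
   of the actual [w] bounds the distance from [w] to the series by
   [|w - P(w)| / (1 - t)]. *)

Set Implicit Arguments.
Unset Strict Implicit.
Unset Printing Implicit Defensive.

Local Open Scope classical_set_scope.
Local Open Scope ring_scope.

(** * Multi-indices and the multinomial theorem *)

Definition index_weight (k : seq nat) : nat := (\sum_(i < size k) i * nth 0 k i)%N.

Lemma index_weight_cons a k : index_weight (a :: k) = (index_weight k + sumn k)%N.
Proof.
rewrite /index_weight big_ord_recl /= mul0n add0n sumnE (big_nth 0%N) big_mkord -big_split.
by apply: eq_bigr => i _; rewrite mulSn addnC.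
Qed.

(** [L] bounds the length, [n] is the sum of the entries and [m] the index weight. Removing the head
    [a] leaves the sum [n - a], and shifting the other indices down by one lowers the weight by this
    same [n - a]. Stopping as soon as [n = 0] lists each multi-index once, without trailing
    zeros. *)
Fixpoint multi_indices (L n m : nat) : seq (seq nat) :=
  match n, L with
  | 0, _ => if m is 0 then [:: [::]] else [::]
  | _.+1, 0 => [::]
  | _.+1, L'.+1 =>
    [seq a :: k | a <- iota 0 n.+1,
       k <- if (n - a <= m)%N then multi_indices L' (n - a) (m - (n - a))
            else [::]]
  end.

Lemma multi_indicesSS L n m : multi_indices L.+1 n.+1 m =
  [seq a :: k | a <- iota 0 n.+2,
     k <- if (n.+1 - a <= m)%N
          then multi_indices L (n.+1 - a) (m - (n.+1 - a)) else [::]].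
Proof. by []. Qed.

(* Trailing zeros are excluded, as by [1 <= k_m] in [Xi]; the default value [1]
   admits the empty tuple, which stands for the zero multi-index. *)
Lemma mem_multi_indices L n m k :
  (k \in multi_indices L n m) =
  [&& last 1%N k != 0%N, (size k <= L)%N, sumn k == n & index_weight k == m].
Proof.
have trim0 (s : seq nat) : last 1%N s != 0%N -> sumn s = 0%N -> s = [::].
  case: s => // a s la; rewrite lastI sumn_rcons => /eqP.
  by rewrite addn_eq0 [last _ _ == _](negbTE la) andbF.
elim: L n m k => [|L IH] [|n] m k; rewrite ?multi_indicesSS.
- case: k => [|a k]; first by rewrite /index_weight /= big_ord0; case: m.
  by rewrite ltn0 andbF /=; case: m.
- by case: k => [|a k] //; rewrite ltn0 !andbF.
- rewrite /=; apply/idP/idP;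
    first by case: m => // /[!inE] /eqP ->; rewrite /index_weight big_ord0.
  case/and4P=> /trim0 + _ /eqP sk => /(_ sk) ->.
  by rewrite /index_weight big_ord0 => /eqP <-.
apply/allpairsPdep/idP => [[a [s [aP sP ->]]]|].
  have {}aP : (a <= n.+1)%N by move: aP; rewrite mem_iota add0n ltnS.
  case: ifP sP => // lm; rewrite IH => /and4P[ls ss /eqP sn /eqP ws].
  rewrite /= ltnS ss index_weight_cons sn ws subnKC // subnK // !eqxx !andbT.
  case: s ls sn {ss ws} => //= _ /esym/eqP; rewrite subn_eq0.
  by case: a {lm} aP.
case: k => // a s; rewrite index_weight_cons => /and4P[ls ss /eqP sn /eqP ws].
exists a, s; split; last by [].
  by rewrite mem_iota add0n ltnS -sn [sumn _]/= leq_addr.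
have -> : (n.+1 - a)%N = sumn s by rewrite -sn [sumn (_ :: _)]/= addKn.
rewrite -ws leq_addl addnK IH
  -[(size s <= L)%N]/(size (a :: s) <= L.+1)%N ss !eqxx !andbT /=.
by case: s ls {ss sn ws}.
Qed.

Lemma multi_indices_uniq L n m : uniq (multi_indices L n m).
Proof.
elim: L n m => [|L IH] [|n] m; rewrite ?multi_indicesSS; try by case: m.
apply: allpairs_uniq_dep.
- exact: (iota_uniq 0 n.+2).
- by move=> a _; case: ifP.
- by move=> [a s] [a' s'] _ _ /= [-> ->].
Qed.

(** A product of divided powers: times [n!], for [n] the sum of [k], it is the corresponding term of
    the multinomial expansion. *)
Definition monomial (R : numFieldType) (b : nat -> R) (k : seq nat) : R :=
  \prod_(i < size k) (b i ^+ nth 0%N k i / (nth 0%N k i)`!%:R).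

Lemma monomial_cons (R : numFieldType) (b : nat -> R) a k :
  monomial b (a :: k) = b 0%N ^+ a / a`!%:R * monomial (b \o S) k.
Proof. by rewrite /monomial big_ord_recl. Qed.

Lemma fact_neq0 (R : numFieldType) n : n`!%:R != 0 :> R.
Proof. by rewrite pnatr_eq0 -lt0n fact_gt0. Qed.

(** Induction on [L]: write the polynomial as b_0 + X Q and expand by the binomial theorem. The
    exponent [a] of b_0 becomes the head of the multi-index, and the factor X^(n - a) accounts for
    the drop in weight. *)
Lemma multinomial (R : numFieldType) L n m (b : nat -> R) :
  ((\poly_(i < L) b i) ^+ n)`_m =
  n`!%:R * \sum_(k <- multi_indices L n m) monomial b k.
Proof.
elim: L n m b => [|L IH] [|n] m b.
- rewrite expr0 coef1 /= fact0 mul1r.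
  by case: m => [|m]; rewrite ?big_nil // big_seq1 /monomial big_ord0.
- by rewrite poly_def big_ord0 expr0n /= coef0 big_nil mulr0.
- rewrite expr0 coef1 /= fact0 mul1r.
  by case: m => [|m]; rewrite ?big_nil // big_seq1 /monomial big_ord0.
have -> : \poly_(i < L.+1) b i = (b 0%N)%:P + (\poly_(i < L) b i.+1) * 'X.
  apply/polyP => -[|i]; rewrite coefD coefMX coefC !coef_poly /= ?addr0 //.
  by rewrite add0r ltnS.
set Q := \poly_(i < L) _.
rewrite addrC exprDn coef_sum multi_indicesSS big_allpairs_dep.
rewrite -[iota 0 _]/(index_iota 0 n.+2) big_mkord mulr_sumr; apply: eq_bigr => -[a /=].
rewrite ltnS => an _.
rewrite coefMn mulrC -polyC_exp coefCM exprMn coefMXn ltnNge.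
under eq_bigr do rewrite monomial_cons.
rewrite -mulr_sumr; case: (leqP _ m) => am /=; last by rewrite big_nil !mulr0 mul0rn.
rewrite IH -mulr_natl -(bin_fact an) !natrM mulrA.
set Z := bigop _ _ _; field.
exact: fact_neq0.
Qed.

(** * Truncated Lagrange series and their recursion *)

(* The part of degree [n] in the coefficients [b] of [w ^ j], where [w] is the
   formal solution of [w = b_0 + b_1 w + ... + b_(L-1) w ^ (L-1)]. *)
Definition root_pow_part (R : numFieldType) L (b : nat -> R) (n j : nat) : R :=
  if n is 0 then (j == 0%N)%:R
  else j%:R / n%:R * ('X^j * (\poly_(i < L) b i) ^+ n)`_n.

(* Extracting coefficients in [w ^ (j + 1) = \sum_i b_i w ^ (j + i)] turns
   Lagrange inversion into a linear recursion, which is checked by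
   differentiating ['X^j * P ^+ n.+1]. *)
Lemma root_pow_partSS (R : numFieldType) L (b : nat -> R) n j :
  root_pow_part L b n.+1 j.+1 = \sum_(i < L) b i * root_pow_part L b n (j + i).
Proof.
case: n => [|n] /=.
  rewrite divr1 expr1 coefXnM coef_poly; case: L => [|L].
    by rewrite big_ord0 /= if_same mulr0.
  rewrite big_ord_recl /= addn0 big1 ?addr0; last first.
    by move=> i _; rewrite addnS mulr0.
  by case: j => [|j]; rewrite ?mulr0 // mul1r mulr1.
set P := \poly_(i < L) b i.
have -> : 'X^(j.+1) * P ^+ n.+2 = 'X^j * P ^+ n.+2 * 'X by rewrite exprS; ring.
rewrite coefMX /=.
(* On the right-hand side the factor [j + i] splits: the [j] part gives [c] because P^(n+2) = P
   P^(n+1), the [i] part gives [d] because X P' is the sum of the i b_i X^i. *)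
pose c := ('X^j * P ^+ n.+2)`_n.+1.
pose d := ('X^j * ('X * P^`()) * P ^+ n.+1)`_n.+1.
have PE : P = \sum_(i < L) b i *: 'X^i by rewrite /P poly_def.
have -> : \sum_(i < L) b i * ((j + i)%:R / n.+1%:R * ('X^(j + i) * P ^+ n.+1)`_n.+1)
   = (j%:R * c + d) / n.+1%:R.
  have -> : c = \sum_(i < L) b i * ('X^(j + i) * P ^+ n.+1)`_n.+1.
    rewrite /c exprS [X in 'X^_ * (X * _)]PE mulrA mulr_sumr mulr_suml coef_sum.
    by apply: eq_bigr => i _; rewrite -scalerAr -scalerAl coefZ exprD.
  have -> : d = \sum_(i < L) i%:R * (b i * ('X^(j + i) * P ^+ n.+1)`_n.+1).
    rewrite /d [X in X^`()]PE raddf_sum mulr_sumr mulr_sumr mulr_suml coef_sum.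
    apply: eq_bigr => i _; rewrite /= derivZ derivXn -scalerAr -scalerAr -scalerAl coefZ.
    rewrite [RHS]mulrCA.
    congr (_ * _); rewrite mulrnAr mulrnAr mulrnAl coefMn mulr_natl.
    case: (nat_of_ord i) => // k; congr (_ *+ _).
    by rewrite -exprS exprD.
  rewrite mulr_sumr -big_split mulr_suml; apply: eq_bigr => i _ /=.
  by rewrite natrD; ring.
(* The operator X d/dX multiplies the coefficient of degree n + 1 by n + 1; by the product rule the
   same coefficient is j c + (n + 2) d. *)
have cd : n.+1%:R * c = j%:R * c + n.+2%:R * d.
  have := coefXM ('X^j * P ^+ n.+2)^`() n.+1.
  rewrite /= coef_deriv -/c => E; rewrite mulr_natl -E.
  rewrite derivM derivXn deriv_exp /=.
  have -> : 'X * ('X^(j.-1) *+ j * P ^+ n.+2 + 'X^j * (P^`() * P ^+ n.+1 *+ n.+2)) =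
     ('X^j * P ^+ n.+2) *+ j + 'X^j * ('X * P^`()) * P ^+ n.+1 *+ n.+2.
    case: (j) => [|k] /=; rewrite ?mulr0n ?exprS; ring.
  by rewrite coefD !coefMn !mulr_natl.
have n1 : n.+1%:R != 0 :> R by rewrite pnatr_eq0.
have n2 : n.+2%:R != 0 :> R by rewrite pnatr_eq0.
have -> : d = (n.+1%:R * c - j%:R * c) / n.+2%:R.
  by rewrite cd [_ * c + _]addrC addrK mulrC mulKf.
rewrite -/c -(natr1 j) -(natr1 n.+1) in n2 *; field.
by rewrite [1 + _]addrC natr1 n1 n2.
Qed.

Lemma root_pow_part0 (R : numFieldType) L (b : nat -> R) n :
  root_pow_part L b n 0 = (n == 0%N)%:R.
Proof. by case: n => //= n; rewrite !mul0r. Qed.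

(** This is V_n(j). *)
Definition root_pow (R : numFieldType) L (b : nat -> R) (n j : nat) : R :=
  \sum_(i < n.+1) root_pow_part L b i j.

Lemma root_pow0 (R : numFieldType) L (b : nat -> R) n :
  root_pow L b n 0 = 1.
Proof.
rewrite /root_pow big_ord_recl root_pow_part0 big1 ?addr0 // => i _.
by rewrite root_pow_part0.
Qed.

Lemma root_powSS (R : numFieldType) L (b : nat -> R) n j :
  root_pow L b n.+1 j.+1 = \sum_(i < L) b i * root_pow L b n (j + i).
Proof.
rewrite /root_pow big_ord_recl add0r.
under eq_bigr do rewrite root_pow_partSS.
by rewrite exchange_big; apply: eq_bigr => i _ /=; rewrite mulr_sumr.
Qed.

(** The sequence r^j is a supersolution: the recursion [root_powSS] preserves the bound because r^j
    P(r) <= r^(j+1). *)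
Lemma root_pow_le (R : realFieldType) L (b : nat -> R) (r : R) n j :
  (forall i, 0 <= b i) -> 0 <= r -> \sum_(i < L) b i * r ^+ i <= r ->
  root_pow L b n j <= r ^+ j.
Proof.
move=> b0 r0 br; elim: n j => [|n IH] [|j].
- by rewrite root_pow0.
- by rewrite /root_pow big_ord_recl big_ord0 /= addr0 exprn_ge0.
- by rewrite root_pow0.
rewrite root_powSS exprSr; apply: le_trans (ler_wpM2l (exprn_ge0 j r0) br).
rewrite mulr_sumr; apply: ler_sum => i _.
by rewrite mulrCA -exprD ler_wpM2l.
Qed.

(** The powers of [w] satisfy [root_powSS] up to the error (w - P(w)) w^j, so the distance divided
    by r^j obeys d_(n+1) <= t d_n + e/r. The bound starts from d_0 <= 1, and [e / r / (1 - t)] is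
    the fixed point of c -> t c + e/r. *)
Lemma root_pow_dist (R : realFieldType) L (b : nat -> R) (r t w e : R) n j :
  0 < r -> 0 <= t -> t < 1 -> `|w| <= r ->
  \sum_(i < L) `|b i| * r ^+ i <= t * r ->
  `|w - \sum_(i < L) b i * w ^+ i| <= e ->
  `|root_pow L b n j - w ^+ j| <= (t ^+ n + e / r / (1 - t)) * r ^+ j.
Proof.
move=> r0 t0 t1 wr br we.
have rn := ltW r0.
have wrX i : `|w| ^+ i <= r ^+ i by rewrite lerXn2r ?nnegrE.
have e0 : 0 <= e by apply: le_trans we.
have c0 : 0 <= e / r / (1 - t).
  by rewrite !divr_ge0 // subr_ge0 ltW.
elim: n j => [|n IH] [|j].
- by rewrite root_pow0 subrr normr0 !mulr1 addr_ge0.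
- rewrite /root_pow big_ord_recl big_ord0 /= !addr0 sub0r normrN normrX.
  apply: le_trans (_ : 1 * r ^+ j.+1 <= _); first by rewrite mul1r wrX.
  by rewrite ler_wpM2r ?exprn_ge0 ?lerDl.
- by rewrite root_pow0 subrr normr0 mulr1 addr_ge0 ?exprn_ge0.
set C := t ^+ n + _ in IH.
have -> : t ^+ n.+1 + e / r / (1 - t) = t * C + e / r.
  rewrite /C exprS; field.
  by rewrite gt_eqF //= subr_eq0 gt_eqF.
rewrite root_powSS.
have -> : \sum_(i < L) b i * root_pow L b n (j + i) - w ^+ j.+1 =
  \sum_(i < L) b i * (root_pow L b n (j + i) - w ^+ (j + i))
    - (w - \sum_(i < L) b i * w ^+ i) * w ^+ j.
  under [in RHS]eq_bigr do rewrite mulrBr.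
  rewrite sumrB mulrBl -exprS mulr_suml.
  under [X in _ = _ - X - _]eq_bigr do rewrite exprD [w ^+ j * _]mulrC mulrA.
  ring.
apply: le_trans (ler_normB _ _) _; rewrite [leRHS]mulrDl; apply: lerD.
  apply: le_trans (ler_norm_sum _ _ _) _.
  apply: le_trans (_ : \sum_(i < L) (C * r ^+ j) * (`|b i| * r ^+ i) <= _).
    apply: ler_sum => i _; rewrite normrM mulrCA ler_wpM2l // -mulrA -exprD.
    exact: IH.
  rewrite -mulr_sumr exprS.
  have -> : t * C * (r * r ^+ j) = (C * r ^+ j) * (t * r) by ring.
  by rewrite ler_wpM2l // mulr_ge0 ?addr_ge0 ?exprn_ge0.
rewrite normrM normrX exprS mulrA divfK ?gt_eqF //.
by rewrite ler_pM ?exprn_ge0.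
Qed.

(** For j = 1 the Lagrange factor 1/(i + 1) turns the (i + 1)! of [multinomial] into i!, the
    numerator in [Ccoef]. *)
Lemma root_pow1 (R : numFieldType) L (b : nat -> R) n :
  root_pow L b n 1 =
  \sum_(i < n) i`!%:R * \sum_(k <- multi_indices L i.+1 i) monomial b k.
Proof.
rewrite /root_pow big_ord_recl add0r; apply: eq_bigr => i _ /=.
rewrite expr1 coefXM /= multinomial factS natrM mul1r !mulrA.
by rewrite mulVf ?mul1r // pnatr_eq0.
Qed.

Lemma normr_monomial (R : realFieldType) (b : nat -> R) k :
  `|monomial b k| = monomial (fun i => `|b i|) k.
Proof.
rewrite /monomial normr_prod; apply: eq_bigr => i _.
by rewrite normrM normrX normfV normr_nat.
Qed.

(** * Unordered sums over a disjoint union of finite layers *)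

(** For nonnegative terms the unordered sum may be grouped by layers; the bound [B] makes it finite,
    so that [fine] loses nothing. *)
Lemma esum_bigcup_seq (R : realType) (T : choiceType) (s : nat -> seq T)
    (a : T -> R) (B : R) :
  (forall n, uniq (s n)) -> trivIset setT (fun n => [set` s n]) ->
  (forall k, 0 <= a k) ->
  (forall n, \sum_(i < n) \sum_(k <- s i) a k <= B) ->
  (\esum_(k in \bigcup_n [set` s n]) (a k)%:E <= B%:E)%E /\
  \sum_(i < n) \sum_(k <- s i) a k @[n --> \oo] -->
    fine (\esum_(k in \bigcup_n [set` s n]) (a k)%:E).
Proof.
move=> us ts a0 aB.
have -> : (\esum_(k in \bigcup_n [set` s n]) (a k)%:E =
          \sum_(0 <= n <oo) (\sum_(k <- s n) a k)%:E)%E.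
  rewrite nneseries_sum_bigcup //.
  apply: eq_eseriesr => n _; rewrite esum_fset -?fsbig_seq ?sumEFin //.
  by move=> k _; rewrite lee_fin.
have s0 n : (0 <= (\sum_(k <- s n) a k)%:E)%E.
  by rewrite lee_fin sumr_ge0.
have sE n : (\sum_(0 <= i < n) (\sum_(k <- s i) a k)%:E)%E =
    (\sum_(i < n) \sum_(k <- s i) a k)%:E.
  by rewrite sumEFin big_mkord.
have cv : cvgn (fun n => (\sum_(0 <= i < n) (\sum_(k <- s i) a k)%:E)%E).
  exact: is_cvg_nneseries.
have leB : (\sum_(0 <= n <oo) (\sum_(k <- s n) a k)%:E <= B%:E)%E.
  by apply: lime_le => //; apply: nearW => n; rewrite sE lee_fin.
split=> //.
suff h : (\sum_(i < n) \sum_(k <- s i) a k)%:E @[n --> \oo] -->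
    (fine (\sum_(0 <= n <oo) (\sum_(k <- s n) a k)%:E)%E)%:E by exact: (fine_cvg h).
rewrite fineK; last first.
  rewrite ge0_fin_numE; last exact: nneseries_ge0.
  by apply: le_lt_trans leB _; rewrite ltry.
by under eq_fun do rewrite -sE.
Qed.

(** The positive and negative parts are both dominated by the absolute values, so the nonnegative
    case applies to each. *)
Lemma set_sum_bigcup_seq (R : realType) (T : choiceType) (s : nat -> seq T)
    (a : T -> R) (B : R) :
  (forall n, uniq (s n)) -> trivIset setT (fun n => [set` s n]) ->
  (forall n, \sum_(i < n) \sum_(k <- s i) `|a k| <= B) ->
  summable (\bigcup_n [set` s n]) (fun k => (a k)%:E) /\
  \sum_(i < n) \sum_(k <- s i) a k @[n --> \oo] -->
    set_sum (\bigcup_n [set` s n]) a.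
Proof.
move=> us ts aB.
have [s1 _] := esum_bigcup_seq us ts (fun k => normr_ge0 (a k)) aB.
split.
  by apply: le_lt_trans s1 _; rewrite ltry.
have ppos n : \sum_(i < n) \sum_(k <- s i) a^\+ k <= B.
  apply: le_trans (aB n); apply: ler_sum => i _; apply: ler_sum => k _.
  by rewrite /funrpos ge_max ler_norm normr_ge0.
have pneg n : \sum_(i < n) \sum_(k <- s i) a^\- k <= B.
  apply: le_trans (aB n); apply: ler_sum => i _; apply: ler_sum => k _.
  by rewrite /funrneg ge_max -normrN ler_norm normr_ge0.
have [_ cp] := esum_bigcup_seq us ts (funrpos_ge0 a) ppos.
have [_ cn] := esum_bigcup_seq us ts (funrneg_ge0 a) pneg.
rewrite (_ : (fun n => _) = (fun n => \sum_(i < n) \sum_(k <- s i) a^\+ k) -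
  (fun n => \sum_(i < n) \sum_(k <- s i) a^\- k)); first exact: cvgB.
apply/funext => n; rewrite fctE -sumrB; apply: eq_bigr => i _.
by rewrite -sumrB; apply: eq_bigr => k _; exact: (congr1 (@^~ k) (esym (funrposBneg a))).
Qed.

(** * The series of the theorem as a Lagrange series *)

Lemma weightE k : weight k = index_weight k.
Proof.
rewrite /weight /index_weight; case: k => [|a k]; first by rewrite big_ord0 big_geq.
by rewrite big_add1 big_mkord [RHS]big_ord_recl mul0n.
Qed.

(** Each (i!)^(k_i) of [Ccoef] is absorbed by the i-th derivative, which becomes a Taylor
    coefficient. *)
Lemma termE (R : realType) (f : R -> R) x k :
  term f x k = (index_weight k)`!%:R * monomial (fun i => derive1n i f x / i`!%:R) k.
Proof.
rewrite /term /Ccoef weightE /monomial; case: k => [|a k].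
  by rewrite /kth !big_geq //= big_ord0 fact0 expr0 invr1 !mulr1.
rewrite !big_add1 !big_mkord big_ord_recl /kth /= fact0 divr1.
rewrite [X in _ = _ * (_ * X)](_ : _ =
  (\prod_(i < size k) ((nth 0 k i)`!%:R * i.+1`!%:R ^+ nth 0 k i))^-1 *
  \prod_(i < size k) derive1n i.+1 f x ^+ nth 0 k i); first by ring.
rewrite -prodfV -big_split; apply: eq_bigr => i _ /=.
by rewrite expr_div_n invfM; ring.
Qed.

Arguments multi_indices : simpl never.

(** The grade is [n.+1] because the union in [Xi] starts at 1. The bound m <= N is the length bound,
    while m <= n follows from 1 <= k_m and m k_m <= n. *)
Lemma XiE N : Xi N = \bigcup_n [set` multi_indices N.+1 n.+2 n.+1].
Proof.
apply/seteqP; split=> k /=.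
  move=> [n /= n1 [m /= /andP[m1]]]; rewrite leq_min => /andP[mn mN].
  move=> [sk km s1 s2]; exists n.-1 => //=; rewrite mem_multi_indices prednK //.
  rewrite sk ltnS mN -weightE /weight sk s2 eqxx andbT /=.
  rewrite -nth_last sk /= (set_nth_default 0%N) ?sk // -lt0n km /=.
  rewrite sumnE (big_nth 0%N) sk big_ltn // -/(kth k 0) -s1.
  by apply/eqP; congr (_ + _)%N.
case=> n _ /=; rewrite mem_multi_indices => /and4P[lk sk /eqP s1 /eqP w1].
have k2 : (1 < size k)%N.
  case: k w1 {lk sk s1} => [|a [|b k]] //.
    by rewrite /index_weight big_ord0.
  by rewrite /index_weight big_ord1.
have k0 : kth k (size k).-1 != 0%N.
  by rewrite /kth nth_last; case: (k) k2 lk.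
have [p sp] : exists p, size k = p.+1 by exists (size k).-1; rewrite prednK // ltnW.
rewrite -weightE /weight sp in w1; rewrite sp /= in k0 k2 sk.
exists n.+1 => //=; exists p => /=.
  have pN : (p <= N)%N by [].
  rewrite leq_min -ltnS k2 pN andbT -w1 big_nat_recr //=.
  by rewrite (leq_trans _ (leq_addl _ _)) // leq_pmulr // lt0n.
split=> //; first by rewrite lt0n.
by rewrite -s1 sumnE [RHS](big_nth 0%N) sp [RHS]big_ltn.
Qed.

Definition taylor_coef (R : realType) (f : R -> R) (x : R) (i : nat) : R :=
  derive1n i f x / i`!%:R.

(** The grade of weight 0 consists of the tuple (1) alone and yields b_0, which is the separate
    summand f(x) of the theorem; the other grades make up [Xi]. *)
Lemma root_powS1 (R : realType) L (b : nat -> R) n :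
  root_pow L.+1 b n.+1 1 = b 0%N +
  \sum_(i < n) \sum_(k <- multi_indices L.+1 i.+2 i.+1) (index_weight k)`!%:R * monomial b k.
Proof.
have e10 : multi_indices L.+1 1 0 = [:: [:: 1%N]] by case: L.
rewrite root_pow1 big_ord_recl /= fact0 e10 big_seq1 mul1r.
rewrite [monomial _ _]big_ord1 expr1 divr1; congr (_ + _).
apply: eq_bigr => i _; rewrite mulr_sumr !big_seq; apply: eq_bigr => k.
by rewrite mem_multi_indices => /and4P[_ _ _ /eqP ->].
Qed.

Lemma trivIset_grades N :
  trivIset setT (fun n => [set` multi_indices N.+1 n.+2 n.+1]).
Proof.
move=> i j _ _ [k [/=]]; rewrite !mem_multi_indices.
by move=> /and4P[_ _ _ /eqP ->] /and4P[_ _ _ /eqP[]].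
Qed.

(** Replacing each Taylor coefficient by its absolute value turns the terms into their absolute
    values, so [root_pow_le] with j = 1 bounds all absolute partial sums by [r]. *)
Lemma summable_term (R : realType) N (f : R -> R) x r :
  0 <= r -> \sum_(i < N.+1) `|taylor_coef f x i| * r ^+ i <= r ->
  summable (Xi N) (fun k => (term f x k)%:E) /\
  root_pow N.+1 (taylor_coef f x) n 1 @[n --> \oo] -->
    f x + set_sum (Xi N) (term f x).
Proof.
move=> r0 br; rewrite XiE.
have [|sm cv] := set_sum_bigcup_seq
  (fun n => multi_indices_uniq N.+1 n.+2 n.+1) (@trivIset_grades N)
  (a := term f x) (B := r).
  move=> n; rewrite -[leRHS]expr1.
  apply: le_trans (root_pow_le (b := fun i => `|taylor_coef f x i|) n.+1 1 _ r0 br); last by [].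
  rewrite root_powS1 -[leLHS]add0r. apply: lerD => //.
  apply: ler_sum => i _; apply: ler_sum => k _.
  by rewrite termE normrM normr_nat normr_monomial.
split=> //; rewrite -cvg_shiftS.
rewrite (_ : [sequence _]_n = cst (f x) +
  (fun n => \sum_(i < n) \sum_(k <- multi_indices N.+1 i.+2 i.+1) term f x k)).
  by apply: cvgD cv; exact: cvg_cst.
apply/funext => n; rewrite [LHS]root_powS1 fctE /taylor_coef fact0 divr1; congr (_ + _).
by apply: eq_bigr => i _; apply: eq_bigr => k _; rewrite termE.
Qed.

(** Let n tend to infinity in [root_pow_dist] with j = 1: t^n vanishes and the factor [r]
    cancels. *)
Lemma fixed_point_dist (R : realType) N (f : R -> R) x r t w e :
  0 < r -> 0 <= t -> t < 1 -> `|w| <= r ->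
  \sum_(i < N.+1) `|taylor_coef f x i| * r ^+ i <= t * r ->
  `|w - \sum_(i < N.+1) taylor_coef f x i * w ^+ i| <= e ->
  `|w - (f x + set_sum (Xi N) (term f x))| <= e / (1 - t).
Proof.
move=> r0 t0 t1 wr br we.
have [|_ cv] := @summable_term R N f x r (ltW r0).
  by apply: le_trans br _; rewrite ger_pMl // ltW.
have -> : e / (1 - t) = (0 + e / r / (1 - t)) * r.
  by field; rewrite subr_eq0 !gt_eqF.
have tn : `|t| < 1 by rewrite ger0_norm.
apply: (@ler_cvg_to _ \oo _ _
  (fun n => `|w - root_pow N.+1 (taylor_coef f x) n 1|)
  (fun n => (t ^+ n + e / r / (1 - t)) * r)).
- by apply: cvg_norm; apply: cvgB cv; exact: cvg_cst.
- apply: cvgM; last exact: cvg_cst.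
  by apply: cvgD; [exact: cvg_expr|exact: cvg_cst].
apply: nearW => n; rewrite distrC -[X in `|_ - X|]expr1 -[X in _ * X]expr1.
exact: root_pow_dist.
Qed.

(** * Taylor's formula with a bound on the oscillation of the top derivative *)

Lemma mvt_le (R : realType) (g dg : R -> R) (x z C : R) :
  (forall u, `|u - x| <= `|z - x| -> is_derive u 1 g (dg u)) ->
  (forall u, `|u - x| <= `|z - x| -> `|dg u| <= C) ->
  `|g z - g x| <= C * `|z - x|.
Proof.
suff H (a b : R) : a <= b ->
   (forall u : R, a <= u <= b -> is_derive u 1 g (dg u)) ->
   (forall u : R, a <= u <= b -> `|dg u| <= C) -> `|g b - g a| <= C * `|b - a|.
  move=> dgP dgC; have [xz|/ltW zx] := leP x z.
    have E u : x <= u <= z -> `|u - x| <= `|z - x|.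
      by move=> /andP[xu uz]; rewrite !ger0_norm ?subr_ge0 // lerB.
    by apply: H => // u /E; [exact: dgP|exact: dgC].
  have E u : z <= u <= x -> `|u - x| <= `|z - x|.
    by move=> /andP[zu ux]; rewrite !ler0_norm ?subr_le0 // lerN2 lerB.
  rewrite distrC (distrC z).
  by apply: H => // u /E; [exact: dgP|exact: dgC].
move=> ab dgP dgC.
have cg : {within `[a, b], continuous g}.
  apply: derivable_within_continuous => u; rewrite in_itv /= => /dgP ?.
  exact: ex_derive.
have [|c cab ->] := @MVT_segment R g dg a b ab _ cg.
  by move=> u; rewrite in_itv /= => /andP[au ub]; apply: dgP; rewrite !ltW.
by rewrite normrM ler_wpM2r // dgC.
Qed.

Lemma derive1nSr (R : realType) n (f : R -> R) :
  derive1n n.+1 f = derive1n n (derive1 f).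
Proof. by rewrite /derive1n iterSr. Qed.

(** Induction on [n]: the remainder of [f] vanishes at [x] and its derivative is the remainder of f'
    of one order less, so [mvt_le] gains a factor |z - x|. The constant 1/n! is given up. *)
Lemma taylor_le (R : realType) n (f : R -> R) (x rho eta : R) :
  (forall i u, (i < n)%N -> `|u - x| <= rho -> derivable (derive1n i f) u 1) ->
  (forall u, `|u - x| <= rho -> `|derive1n n f u - derive1n n f x| <= eta) ->
  forall z, `|z - x| <= rho ->
  `|f z - (\poly_(i < n.+1) taylor_coef f x i).[z - x]| <= eta * `|z - x| ^+ n.
Proof.
elim: n f => [|n IH] f df cf z zr.
  rewrite horner_poly big_ord1 !expr0 !mulr1 /taylor_coef fact0 divr1.
  exact: cf.
set p := \poly_(i < _) _; pose q := p \Po ('X - x%:P).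
have qE u : q.[u] = p.[u - x] by rewrite /q horner_comp !hornerE.
have dp : p^`() = \poly_(i < n.+1) taylor_coef (derive1 f) x i.
  apply/polyP => i; rewrite coef_deriv !coef_poly ltnS; case: ifP => _; last by rewrite mul0rn.
  rewrite /taylor_coef -[LHS]mulr_natr factS natrM derive1nSr invfM mulrA.
  by rewrite mulrAC divfK ?pnatr_eq0.
have dq u : q^`().[u] = (p^`()).[u - x].
  by rewrite /q deriv_comp derivXsubC mulr1 horner_comp !hornerE.
have eta0 : 0 <= eta.
  by apply: le_trans (cf x _); rewrite // subrr normr0 (le_trans _ zr).
have -> : f z - p.[z - x] = (f z - q.[z]) - (f x - q.[x]).
  rewrite !qE subrr [p.[0]]horner_poly big_ord_recl /= expr0 mulr1.
  rewrite big1 => [|i _]; last by rewrite expr0n mulr0.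
  by rewrite addr0 /taylor_coef fact0 divr1 subrr subr0.
rewrite exprSr mulrA.
apply: (@mvt_le R (fun u => f u - q.[u]) (fun u => derive1 f u - q^`().[u])) => u uz.
  have ? : is_derive u 1 f (derive1 f u).
    rewrite derive1E; apply: derivableP.
    by apply: (df 0%N) => //; apply: le_trans zr.
  exact: is_deriveB.
have ur : `|u - x| <= rho by apply: le_trans zr.
rewrite dq dp; apply: le_trans (IH (derive1 f) _ _ u ur) _.
- by move=> i v i_n vr; rewrite -derive1nSr; exact: df.
- by move=> v vr; rewrite -derive1nSr; exact: cf.
by rewrite ler_wpM2l // lerXn2r ?nnegrE.
Qed.

(** * Neighbourhoods of 0 and the contraction radius *)

Lemma nbhs0_ball (R : realType) (P : R -> Prop) :
  (\forall x \near (0 : R), P x) -> exists2 e : R, 0 < e & forall x, `|x| < e -> P x.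
Proof.
move=> /nbhs_normP[e /= e0 eP]; exists e => // x xe; apply: eP.
by rewrite /= sub0r normrN.
Qed.

Lemma Cn_near_continuous (R : realType) N (f : R -> R) a i :
  Cn_near N f a -> (i <= N)%N -> {for a, continuous (derive1n i f)}.
Proof.
move=> /nbhs_singleton[df cf]; rewrite leq_eqVlt => /predU1P[-> //|iN].
exact/differentiable_continuous/derivable1_diffP/df.
Qed.

(** At x = 0 the sum is r q(r), as f(0) = 0, and q(0) = |f'(0)| < t. A small [r] gives q(r) < t, and
    this strict inequality persists for [x] near 0 by continuity of the Taylor coefficients. *)
Lemma majorant_radius (R : realType) N (f : R -> R) (t : R) :
  (1 <= N)%N -> Cn_near N f 0 -> f 0 = 0 -> `|derive1 f 0| < t ->
  exists2 r : R, 0 < r &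
    \forall x \near (0 : R), \sum_(i < N.+1) `|taylor_coef f x i| * r ^+ i <= t * r.
Proof.
move=> N1 hf f0 ft.
pose q := \poly_(i < N) `|taylor_coef f 0 i.+1|.
have q0 : q.[0] < t.
  rewrite horner_coef0 coef_poly N1 /taylor_coef factS fact0 muln1 divr1.
  by rewrite /derive1n.
have /nbhs0_ball[e e0 eq] : \forall r \near (0 : R), q.[r] < t.
  have cq : q.[u] @[u --> (0 : R)] --> q.[0] by exact: continuous_horner.
  exact: (cvgr_lt _ cq).
have r0 : 0 < e / 2 by rewrite divr_gt0.
exists (e / 2) => //; set r := e / 2 in r0 *.
have qr : q.[r] < t.
  by apply: eq; rewrite gtr0_norm // /r; lra.
near=> x; apply: ltW; near: x.
apply: (@cvgr_lt _ _ _ _ _ (\sum_(i < N.+1) `|taylor_coef f 0 i| * r ^+ i)).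
  apply: cvg_big => [|i _]; first exact: add_continuous.
  apply: cvgM; last exact: cvg_cst.
  apply: cvg_norm; apply: cvgM; last exact: cvg_cst.
  by apply: Cn_near_continuous hf _; rewrite -ltnS.
rewrite big_ord_recl /taylor_coef /derive1n /= f0 mul0r normr0 mul0r add0r.
apply: le_lt_trans (_ : q.[r] * r < _); last by rewrite ltr_pM2r.
rewrite horner_poly mulr_suml; apply: ler_sum => i _.
by rewrite /bump /= add1n exprSr mulrA.
Unshelve. all: by end_near.
Qed.

(** * The asymptotic estimate *)

Unset Implicit Arguments.
Set Strict Implicit.
Set Printing Implicit Defensive.

Theorem theorem3p3 (R : realType) (N : nat) (f y : R -> R)
    (hN : (1 <= N)%N)
    (hf : Cn_near N f 0)
    (hf0 : f 0 = 0)
    (hf'0 : `|derive1 f 0| < 1)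
    (hy : \forall x \near (0 : R), y x = x + f (y x))
    (hy0 : y x @[x --> 0^'] --> (0 : R)) :
  (\forall x \near (0 : R), summable (Xi N) (fun k => (term f x k)%:E)) /\
  (y x - (x + f x + set_sum (Xi N) (term f x))) / x ^+ N @[x --> 0^']
    --> (0 : R).
Proof.
have [t [ft t0 t1]] : exists t, [/\ `|derive1 f 0| < t, 0 < t & t < 1].
  have := normr_ge0 (derive1 f 0).
  by exists ((1 + `|derive1 f 0|) / 2); split; lra.
have [r r0 hr] := majorant_radius hN hf hf0 ft.
split.
  apply: filterS hr => x hx; apply: (summable_term (ltW r0) _).1.
  by apply: le_trans hx _; rewrite ger_pMl // ltW.
apply/cvgr0Pnorm_le => eps eps0.
pose K := (1 - t)^-1.
have K0 : 0 < K by rewrite invr_gt0 subr_gt0.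
(* Chosen so that the final bound eta (K |x|)^N / (1 - t) equals eps |x|^N. *)
pose eta := eps / (K ^+ N * K).
have eta0 : 0 < eta by rewrite divr_gt0 // mulr_gt0 // exprn_gt0.
have [e e0 he] : exists2 e : R, 0 < e & forall u, `|u| < e ->
    [/\ forall i, (i < N)%N -> derivable (derive1n i f) u 1,
        `|derive1 f u| <= t & `|derive1n N f 0 - derive1n N f u| <= eta / 2].
  apply: nbhs0_ball; near=> u; split.
  - by have [] : (forall i, (i < N)%N -> derivable (derive1n i f) u 1) /\
      {for u, continuous (derive1n N f)} by near: u; exact: hf.
  - near: u; apply: cvgr_norm_le ft.
    exact: (Cn_near_continuous (i := 1) hf hN).
  near: u; apply: (cvgrPdist_le _ _).1; last by rewrite divr_gt0.
  exact: Cn_near_continuous hf _.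
have df u : `|u| < e -> derivable f u 1 by move=> /he[/(_ 0%N hN)].
have fy v : `|v| < e -> `|f v| <= t * `|v|.
  move=> ve; have := @mvt_le R f (derive1 f) 0 v t.
  rewrite hf0 !subr0; apply=> u; rewrite subr0 => uv.
    rewrite derive1E; apply: derivableP; apply: df.
    exact: le_lt_trans uv ve.
  by have [] := he u (le_lt_trans uv ve).
near=> x.
have x0 : x != 0 by near: x; exact: nbhs_dnbhs_neq.
(* With |x| and |w| <= |y x| both below e/3, every point within |w| of [x] stays in the ball of
   radius [e]. *)
have xe : `|x| < e / 3 by near: x; apply: dnbhs0_lt; rewrite divr_gt0.
have ye : `|y x| < e / 3.
  by near: x; apply: cvgr0_norm_lt => //; rewrite divr_gt0.
have yr : `|y x| <= r.
  by near: x; apply: (cvgr0Pnorm_le _).1.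
have yE : y x = x + f (y x) by near: x; exact: nbhs_dnbhs hy.
have bx : \sum_(i < N.+1) `|taylor_coef f x i| * r ^+ i <= t * r.
  by near: x; exact: nbhs_dnbhs hr.
pose w := y x - x.
have wE : w = f (y x) by rewrite /w {1}yE addrAC subrr add0r.
have wty : `|w| <= t * `|y x| by rewrite wE fy //; lra.
have wy : `|w| <= `|y x| by apply: le_trans wty _; rewrite ler_piMl // ltW.
(* Combine |w| <= t |y x| with |y x| <= |x| + |w|. *)
have wK : `|w| <= K * `|x|.
  apply: le_trans wy _; rewrite /K mulrC ler_pdivlMr ?subr_gt0 //.
  have : `|y x| <= `|x| + `|w|.
    by rewrite -[y x](subrK x) addrC; apply: ler_normD.
  lra.
(* Taylor's formula at [x], evaluated at [y x], where [f] takes the value [w]. The top derivatives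
   at [u] and at [x] are each within eta/2 of the one at 0. *)
have we : `|w - \sum_(i < N.+1) taylor_coef f x i * w ^+ i| <= eta * (K * `|x|) ^+ N.
  have ux u : `|u - x| <= `|w| -> `|u| < e.
    move=> uw; have : `|u| <= `|u - x| + `|x|.
      by rewrite -{1}[u](subrK x) ler_normD.
    lra.
  have dux i u : (i < N)%N -> `|u - x| <= `|w| -> derivable (derive1n i f) u 1.
    by move=> iN /ux /he[+ _ _]; exact.
  have cux u : `|u - x| <= `|w| -> `|derive1n N f u - derive1n N f x| <= eta.
    move=> /ux /he[_ _ h1].
    have [|_ _ h2] := he x; first lra.
    apply: le_trans (ler_distD (derive1n N f 0) _ _) _.
    by rewrite [eta]splitr lerD // distrC.
  have := taylor_le dux cux (lexx `|w|).
  rewrite -/w horner_poly -wE => /le_trans; apply.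
  by rewrite (ler_wpM2l (ltW eta0)) // lerXn2r ?nnegrE // mulr_ge0 // ltW.
have := fixed_point_dist r0 (ltW t0) t1 (le_trans wy yr) bx we.
have -> : y x - (x + f x + set_sum (Xi N) (term f x)) =
   w - (f x + set_sum (Xi N) (term f x)) by rewrite /w; ring.
move=> D; rewrite normrM normfV normrX ler_pdivrMr ?exprn_gt0 ?normr_gt0 //.
apply: le_trans D _; rewrite [leLHS](_ : _ = eps * `|x| ^+ N) //.
by rewrite -/K exprMn /eta; field; rewrite !gt_eqF // exprn_gt0.
Unshelve. all: by end_near.
Qed.
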